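(* Let $n \geqslant 1$ and let $T$ be a facet 2-colored triangulation of the $n$-sphere. Then the bipyramidal crown over $T$, with its induced coloring of $(n+1)$-simplexes, is a facet 2-colored triangulation of the $(n+1)$-sphere.
   Context: A triangulation of a closed $n$-manifold $M$ is a (finite) simplicial $n$-complex whose carrier is homeomorphic to $M$; its $n$-simplexes are called facets. A facet 2-colored triangulation is a triangulation together with a coloring of its facets with two colors (black and white) such that any two distinct facets that have a common $(n-1)$-face are colored differently (for a triangulation of an $(n+1)$-manifold, facets are the $(n+1)$-simplexes and the condition concerns common $n$-faces). Bipyramidal crown: let $T$ be a facet 2-colored triangulation of a closed $n$-manifold, and let $N$ and $S$ be two distinct new vertices not in $T$. The northern cone over $T$ is the simplicial complex consisting of all simplexes of $T$, the vertex $N$, and all simplexes spanned by $N$ together with a simplex of $T$. The southern cone over $T$ is defined in the same way with $S$ in place of $N$. The bipyramidal crown over $T$ is the union of the northern and southern cones. Its $(n+1)$-simplexes are colored as follows: for each facet $\sigma$ of $T$, the $(n+1)$-simplex spanned by $N$ and $\sigma$ receives the same color as $\sigma$, and the $(n+1)$-simplex spanned by $S$ and $\sigma$ receives the opposite color. *)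

(* Defs.v *)
From mathcomp Require Import all_boot all_order all_algebra.

Set Implicit Arguments.
Unset Strict Implicit.
Unset Printing Implicit Defensive.

Variant color := Black | White.

Definition opposite (a : color) : color :=
  match a with Black => White | White => Black end.

Section Complexes.
Variable V : finType.
Implicit Types (K T : {set {set V}}) (c : {set V} -> color).

(* A finite simplicial complex is given by the vertex sets of its (nonempty)
   simplexes, inside an ambient finite type V. Elements of V need not be
   vertices of K, which leaves room for new vertices. *)
Definition simplicial_complex K : Prop :=
  set0 \notin K /\
  forall s t : {set V}, t \in K -> s \subset t -> s != set0 -> s \in K.

Definition vertices K : {set V} := cover K.

Definition simplexes (n : nat) K : {set {set V}} :=
  [set s in K | #|s| == n.+1].

Definition simplicial_ncomplex (n : nat) K : Prop :=
  [/\ simplicial_complex K,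
      forall s : {set V}, s \in K -> #|s| <= n.+1
    & simplexes n K != set0].

(* Only the values of c on the n-simplexes are relevant. A common (n-1)-face
   has n vertices. *)
Definition facet_2coloring (n : nat) K c : Prop :=
  forall s t : {set V}, s \in simplexes n K -> t \in simplexes n K -> s <> t ->
    (exists r : {set V}, [/\ r \in K, #|r| = n, r \subset s & r \subset t]) ->
    c s <> c t.

Definition cone (v : V) T : {set {set V}} :=
  T :|: [set [set v]] :|: [set v |: s | s in T].

Definition bipyramidal_crown (N S : V) T : {set {set V}} :=
  cone N T :|: cone S T.

(* An (n+1)-simplex of the crown over an n-complex contains exactly one of
   N and S. *)
Definition crown_coloring (N S : V) c (t : {set V}) : color :=
  if N \in t then c (t :\ N) else opposite (c (t :\ S)).

End Complexes.

From mathcomp Require Import all_classical all_reals all_analysis.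
Import Order.TTheory GRing.Theory Num.Theory.
Import numFieldNormedType.Exports.

Local Open Scope classical_set_scope.
Local Open Scope ring_scope.

Definition homeomorphic (X Y : topologicalType) (A : set X) (B : set Y) : Prop :=
  exists (f : X -> Y) (g : Y -> X),
    [/\ set_fun A B f /\ set_fun B A g,
        {in A, cancel f g} /\ {in B, cancel g f},
        {within A, continuous f} & {within B, continuous g}].

(* Standard geometric realization: each vertex v is placed at the basis vector
   e_v of R^V, so a point is given by its barycentric coordinates and lies in
   the relative interior of the simplex spanned by its support. As V is finite,
   the product topology on V -> R is the Euclidean one. *)
Definition carrier (R : realType) (V : finType) (K : {set {set V}}) :
    set {ptws V -> R} :=
  [set x : {ptws V -> R} |
    [/\ forall v, 0 <= x v, \sum_v x v = 1 & finset (fun v => x v != 0) \in K]].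
Arguments carrier : clear implicits.

(* Unit sphere for the Euclidean norm of R^(n+1); the library norm on row
   vectors is the max norm, which induces the same topology. *)
Definition sphere (R : realType) (n : nat) : set 'rV[R]_n.+1 :=
  [set x : 'rV[R]_n.+1 | \sum_i x ord0 i ^+ 2 = 1].
Arguments sphere : clear implicits.

Definition triangulation (R : realType) (n : nat) (V : finType)
    (K : {set {set V}}) (X : topologicalType) (M : set X) : Prop :=
  simplicial_ncomplex n K /\ homeomorphic (carrier R V K) M.

Definition facet_2colored_triangulation (R : realType) (n : nat) (V : finType)
    (K : {set {set V}}) (c : {set V} -> color)
    (X : topologicalType) (M : set X) : Prop :=
  triangulation R n K M /\ facet_2coloring n K c.

(* Main.v *)
Require Import Defs.
From mathcomp Require Import all_boot all_order all_algebra.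

(** A simplex of the crown is a simplex of [T], possibly empty, joined with at
    most one of [N] and [S]; this settles the combinatorial part.  For the
    topological part, a point [x] of the carrier of the crown is determined by
    its height [t = x N - x S] and, when [|t| < 1], by the point [y] of the
    carrier of [T] obtained by rescaling its other coordinates, whose sum is
    [1 - |t|].  If [f] is a homeomorphism from the carrier of [T] to the
    n-sphere, then [x |-> (t, sqrt (1 - t^2) f y)] is a homeomorphism onto the
    (n+1)-sphere.  Continuity of the map and of its inverse at the poles holds
    because a factor tending to 0 multiplies a bounded one. *)

Set Implicit Arguments.
Unset Strict Implicit.
Unset Printing Implicit Defensive.

(** * Combinatorics of the crown: simplexes, dimension and coloring *)

Section Combinatorics.
Variables (V : finType) (T : {set {set V}}) (N S : V).
Hypotheses (T0 : set0 \notin T) (NS : N != S).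
Hypotheses (NT : N \notin vertices T) (ST : S \notin vertices T).

Lemma notin_simplex (v : V) (s : {set V}) :
  v \notin vertices T -> s \in T -> v \notin s.
Proof. by move=> vT sT; apply: contra vT => vs; apply/bigcupP; exists s. Qed.

Lemma setD1_notin (v : V) (s : {set V}) : v \notin s -> s :\ v = s.
Proof. by move=> vs; apply/setDidPl; rewrite disjoint_sym disjoints1. Qed.

Lemma in_cone (v : V) (t : {set V}) :
  v \notin vertices T ->
  (t \in cone v T) =
    (t \in T) || (v \in t) && ((t :\ v == set0) || (t :\ v \in T)).
Proof.
move=> vT; rewrite /cone !inE; case: (t \in T) => //=.
apply/orP/andP => [[/eqP ->|/imsetP[s sT ->]]|[vt /orP[/eqP t0|tT]]].
- by rewrite set11 setDv eqxx.
- by rewrite setU11 setU1K ?sT ?orbT// (notin_simplex vT).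
- by left; rewrite -(setD1K vt) t0 setU0.
- by right; apply/imsetP; exists (t :\ v); rewrite ?setD1K.
Qed.

(** Removing both poles at once gives one criterion for all simplexes of the crown: what is left is
    empty for a pole alone and a simplex of [T] otherwise. As neither pole is a vertex of [T], no
    simplex of either cone contains both. *)
Lemma in_crown (t : {set V}) :
  (t \in bipyramidal_crown N S T) =
  [&& t != set0, ~~ ((N \in t) && (S \in t)) &
      (t :\ N :\ S == set0) || (t :\ N :\ S \in T)].
Proof.
rewrite /bipyramidal_crown inE !in_cone//.
have [->|t0] := eqVneq t set0; first by rewrite (negPf T0) !in_set0.
have [Nt|Nt] := boolP (N \in t); have [St|St] := boolP (S \in t) => /=.
- have tT : t \notin T by apply/negP => /(notin_simplex NT); rewrite Nt.
  have St' : S \in t :\ N by rewrite !inE eq_sym NS.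
  have Nt' : N \in t :\ S by rewrite !inE NS.
  have tN : t :\ N \notin T.
    by apply/negP => /(notin_simplex ST); rewrite St'.
  have tS : t :\ S \notin T.
    by apply/negP => /(notin_simplex NT); rewrite Nt'.
  rewrite (negPf tT) (negPf tN) (negPf tS) !orbF/=.
  apply/negP => /orP[] /eqP E.
    by rewrite E in_set0 in St'.
  by rewrite E in_set0 in Nt'.
- have tT : t \notin T by apply/negP => /(notin_simplex NT); rewrite Nt.
  have E : t :\ N :\ S = t :\ N by apply: setD1_notin; rewrite !inE (negPf St) andbF.
  by rewrite (negPf tT) E /= orbF.
- have tT : t \notin T by apply/negP => /(notin_simplex ST); rewrite St.
  by rewrite (negPf tT) (setD1_notin Nt).
- by rewrite !orbF orbb (setD1_notin Nt) (setD1_notin St) (negPf t0).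
Qed.

Lemma crown_complex (n : nat) :
  simplicial_ncomplex n T -> simplicial_ncomplex n.+1 (bipyramidal_crown N S T).
Proof.
move=> [[_ clT] szT /set0Pn[s0]]; rewrite inE => /andP[s0T /eqP s0n].
split; first split.
- by rewrite in_crown eqxx.
- move=> t s; rewrite !in_crown => /and3P[_ sNS sT] ts -> /=.
  apply/andP; split.
    by apply: contra sNS => /andP[Nt St]; rewrite !(subsetP ts).
  have [//|t0] := eqVneq (t :\ N :\ S) set0.
  have ts' : t :\ N :\ S \subset s :\ N :\ S by do 2!apply: setSD.
  case/orP: sT => [/eqP sE|sT]; last by rewrite (clT _ _ sT ts' t0) orbT.
  by move: ts' t0; rewrite sE subset0 => ->.
- move=> s; rewrite in_crown => /and3P[_ sNS sT].
  have sn : (#|s :\ N :\ S| <= n.+1)%N.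
    by case/orP: sT => [/eqP ->|/szT//]; rewrite cards0.
  (* At most one pole lies in [s], so it adds at most one vertex to the bound [sn]. *)
  rewrite (cardsD1 N) (cardsD1 S) !inE eq_sym NS /=.
  by case: (N \in s) sNS; case: (S \in s) => //= _; rewrite ?add0n ?add1n// leqW.
- apply/set0Pn; exists (N |: s0); rewrite !inE; apply/andP; split.
    by apply/orP; left; apply/orP; right; apply/imsetP; exists s0.
  by rewrite cardsU1 (notin_simplex NT s0T) s0n.
Qed.

(** Simplexes of [T] and single poles have fewer than n+2 vertices, so only the joins of a pole with
    a facet of [T] remain. *)
Lemma crown_facet (n : nat) (t : {set V}) :
  (forall s : {set V}, s \in T -> (#|s| <= n.+1)%N) ->
  t \in simplexes n.+1 (bipyramidal_crown N S T) ->
  exists2 s, s \in simplexes n T & t = N |: s \/ t = S |: s.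
Proof.
move=> szT; rewrite /simplexes inE => /andP[+ /eqP tn]; rewrite in_setU => tK.
have cone_case v : v \notin vertices T -> t \in cone v T ->
    exists2 s, s \in simplexes n T & t = v |: s.
  rewrite /cone !inE => vT /orP[/orP[/szT|/eqP tv]|/imsetP[s sT ts]].
  - by rewrite tn ltnn.
  - by move: tn; rewrite tv cards1.
  - exists s => //; rewrite inE sT.
    by move: tn; rewrite ts cardsU1 (notin_simplex vT sT) add1n => -[->] /=.
by case/orP: tK => [/(cone_case _ NT)|/(cone_case _ ST)] [s sT ->]; exists s; auto.
Qed.

(** Adjacent facets with the same apex have adjacent bases in [T], already colored differently.
    Adjacent facets with different apexes have the same base, and the coloring of the southern cone
    is reversed. *)
Lemma crown_facet_2coloring (n : nat) (c : {set V} -> color) :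
  (1 <= n)%N -> simplicial_ncomplex n T -> facet_2coloring n T c ->
  facet_2coloring n.+1 (bipyramidal_crown N S T) (crown_coloring N S c).
Proof.
move=> n1 [[_ clT] szT _] cT s t sK tK st [r [_ rn rs rt]].
have [s' s'F sE] := crown_facet szT sK; have [t' t'F tE] := crown_facet szT tK.
have [s'T /eqP s'n] : s' \in T /\ #|s'| == n.+1 by move: s'F; rewrite inE => /andP.
have [t'T /eqP t'n] : t' \in T /\ #|t'| == n.+1 by move: t'F; rewrite inE => /andP.
have [Ns' Ss'] := (notin_simplex NT s'T, notin_simplex ST s'T).
have [Nt' St'] := (notin_simplex NT t'T, notin_simplex ST t'T).
have oppK a : opposite a <> a by case: a.
have oppI a b : opposite a = opposite b -> a = b by case: a; case: b.
have colN (u : {set V}) : N \notin u -> crown_coloring N S c (N |: u) = c u.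
  by move=> Nu; rewrite /crown_coloring setU11 setU1K.
have colS (u : {set V}) : N \notin u -> S \notin u ->
    crown_coloring N S c (S |: u) = opposite (c u).
  by move=> Nu Su; rewrite /crown_coloring !inE (negPf NS) (negPf Nu) setU1K.
have sub v (u : {set V}) : v \notin r -> r \subset v |: u -> r \subset u.
  move=> vr ru; apply/subsetP => x xr; have := subsetP ru _ xr.
  by rewrite !inE => /orP[/eqP xv|//]; rewrite -xv xr in vr.
have eqr (u : {set V}) : #|u| = n.+1 -> r \subset u -> r = u.
  by move=> un ru; apply/eqP; rewrite eqEcard ru un rn leqnn.
(* Same apex [v]: if the common face [r] missed [v], it would lie in both bases and, having n+1
   vertices, equal both. So [v] is in [r], and [r :\ v] is a common face of the bases with n
   vertices. *)
have same v : v \notin s' -> v \notin t' -> s = v |: s' -> t = v |: t' ->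
    c s' <> c t'.
  move=> vs' vt' sv tv.
  have s't' : s' <> t' by move=> E; apply: st; rewrite sv tv E.
  apply: (cT _ _ s'F t'F s't'); exists (r :\ v).
  have rs' : r :\ v \subset s' by rewrite subDset -sv.
  have rt' : r :\ v \subset t' by rewrite subDset -tv.
  have vr : v \in r.
    apply/negP => /negP vr; apply: s't'.
    rewrite sv in rs; rewrite tv in rt.
    exact: etrans (esym (eqr _ s'n (sub _ _ vr rs))) (eqr _ t'n (sub _ _ vr rt)).
  have rvn : #|r :\ v| = n by move: (cardsD1 v r); rewrite vr rn => -[].
  split=> //; apply: (clT _ s') => //.
  (* Here [1 <= n] is what makes [r :\ v] nonempty, hence a simplex. *)
  by rewrite -card_gt0 rvn.
(* Different apexes: the common face contains neither, so by cardinality it equals both bases. *)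
have diff v w : v \notin s' -> v != w -> v \notin t' -> w \notin s' ->
    s = v |: s' -> t = w |: t' -> s' = t'.
  move=> vs' vw vt' ws' sv tw.
  have vr : v \notin r.
    by apply: contra vt' => /(subsetP rt); rewrite tw !inE (negPf vw).
  have wr : w \notin r.
    by apply: contra ws' => /(subsetP rs); rewrite sv !inE eq_sym (negPf vw).
  rewrite sv in rs; rewrite tw in rt.
  exact: etrans (esym (eqr _ s'n (sub _ _ vr rs))) (eqr _ t'n (sub _ _ wr rt)).
case: sE => sE; case: tE => tE.
- by rewrite sE tE !colN//; exact: (same N).
- rewrite sE tE colN// colS// (diff N S)// => E; exact: (oppK (c t')).
- rewrite sE tE colN// colS// (diff S N)// 1?eq_sym//; exact: oppK.
- by rewrite sE tE !colS// => /oppI; exact: (same S).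
Qed.

End Combinatorics.

From mathcomp Require Import all_classical all_reals all_analysis.
From mathcomp Require Import ring.
Import Order.TTheory GRing.Theory Num.Theory.
Import numFieldNormedType.Exports.

Local Open Scope classical_set_scope.
Local Open Scope ring_scope.

(** * Convergence by coordinates, and products with a bounded factor *)

Section Convergence.
Variable R : realType.

Lemma cvg_ptws (I : Type) (X : Type) (F : set_system X) (FF : Filter F)
    (h : X -> {ptws I -> R}) (l : {ptws I -> R}) :
  (forall i, h x i @[x --> F] --> l i) -> h x @[x --> F] --> l.
Proof.
move=> hl; apply/cvg_sup => i A.
rewrite /= (@nbhsE (initial_topology (fun x : {ptws I -> R} => x i))).
move=> -[B [[C oC <-] Cl] sBA].
apply: (filterS sBA); apply: (hl i C).
by apply: open_nbhs_nbhs; split.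
Qed.

Lemma ptws_coord_continuous (I : eqType) (i : I) :
  continuous (fun x : {ptws I -> R} => x i).
Proof. exact: (@proj_continuous I (fun=> R)). Qed.

Lemma cvg_rV (n : nat) (X : Type) (F : set_system X) (FF : Filter F)
    (h : X -> 'rV[R]_n) (l : 'rV[R]_n) :
  (forall i, h x ord0 i @[x --> F] --> l ord0 i) -> h x @[x --> F] --> l.
Proof.
move=> hl A [P lP sPA]; rewrite /=.
have hP : \forall x \near F, forall i : 'I_n, P ord0 i (h x ord0 i).
  by apply: filter_forall => i; exact: hl (lP ord0 i).
apply: filterS hP => x hx; apply: sPA => i j.
by rewrite (ord1 i).
Qed.

(** Allows composition with a map that is continuous only within [D]. *)
Lemma cvg_to_within (X : Type) (Y : topologicalType) (F : set_system X)
    (FF : Filter F) (D : set Y) (h : X -> Y) (l : Y) :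
  h x @[x --> F] --> l -> (\forall x \near F, D (h x)) ->
  h x @[x --> F] --> within D (nbhs l).
Proof.
move=> hl hD A lA; rewrite /=.
have hA : \forall x \near F, D (h x) -> A (h x) by exact: hl lA.
by apply: filterS2 hD hA => x Dx; exact.
Qed.

(** Handles the poles: if [l] is 0, the product is squeezed between [- |a|] and [|a|], so [b] need
    not converge. The bound on [b] is asked only where [a] is nonzero, since [b] may take
    meaningless values elsewhere. *)
Lemma cvgM_bounded (X : Type) (F : set_system X) (FF : Filter F)
    (a b : X -> R) (l m : R) :
  a x @[x --> F] --> l -> (l != 0 -> b x @[x --> F] --> m) ->
  (\forall x \near F, a x != 0 -> `|b x| <= 1) ->
  a x * b x @[x --> F] --> l * m.
Proof.
move=> al bm ab; have [l0|l0] := eqVneq l 0; last exact: cvgM al (bm l0).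
rewrite l0 mul0r; rewrite l0 in al.
have al0 : `|a x| @[x --> F] --> (0 : R).
  by have := cvg_norm al; rewrite normr0; exact.
have al0N : - `|a x| @[x --> F] --> (0 : R).
  by have := cvgN al0; rewrite oppr0; exact.
apply: squeeze_cvgr al0N al0.
apply: filterS ab => x abx.
rewrite -ler_norml normrM; have [->|/abx b1] := eqVneq (a x) 0.
  by rewrite normr0 mul0r.
by rewrite ler_piMr.
Qed.

End Convergence.

(** * Height and equatorial point on the carrier of the crown *)

Section Crown.
Variables (R : realType) (V : finType) (T : {set {set V}}) (N S : V).
Hypotheses (T0 : finset.set0 \notin T) (NS : N != S).
Hypotheses (NT : N \notin vertices T) (ST : S \notin vertices T).
Implicit Types x y : {ptws V -> R}.

Local Notation crown := (bipyramidal_crown N S T).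

Lemma carrier_le1 (K : {set {set V}}) x v : carrier R V K x -> x v <= 1.
Proof.
by move=> [x0 <- _]; rewrite (bigD1 v)//= lerDl; apply: sumr_ge0 => w _; exact: x0.
Qed.

Lemma carrier_new_vertex y v : v \notin vertices T -> carrier R V T y -> y v = 0.
Proof.
move=> vT [_ _ yT]; apply/eqP.
by have := notin_simplex vT yT; rewrite inE negbK.
Qed.

Lemma sum_poles x :
  \sum_v x v = x N + x S + \sum_(v | (v != N) && (v != S)) x v.
Proof. by rewrite (bigD1 N)//= (bigD1 S) 1?eq_sym//= addrA. Qed.

(** Translates [in_crown] to barycentric coordinates: a zero product means that the support contains
    at most one pole, and the disjunction separates the poles from the points with an equatorial
    part. *)
Lemma carrier_crownP x :
  carrier R V crown x <->
  [/\ forall v, 0 <= x v, \sum_v x v = 1, x N * x S = 0 &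
      (forall v, v != N -> v != S -> x v = 0) \/
      finset (fun v => [&& v != N, v != S & x v != 0]) \in T].
Proof.
have restE : finset (fun v => x v != 0) :\ N :\ S =
    finset (fun v => [&& v != N, v != S & x v != 0]).
  by apply/finset.setP => v; rewrite !inE; case: eqP; case: eqP.
rewrite /carrier /= in_crown// restE !inE; split.
- move=> [x0 x1 /and3P[_ xNS xT]]; split => //.
    by apply/eqP; rewrite mulf_eq0 -[_ || _]negbK negb_or.
  case/orP: xT => [/eqP/finset.setP xT|]; [left|by right] => v vN vS.
  by have := xT v; rewrite !inE vN vS => /= /negbT; rewrite negbK => /eqP.
- move=> [x0 x1 xNS xT]; split=> //; apply/and3P; split.
  + apply/negP => /eqP/finset.setP x00.
    suff : (0 : R) = 1 by move/eqP; rewrite eq_sym oner_eq0.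
    rewrite -x1 big1// => v _; apply/eqP.
    by have := x00 v; rewrite !inE => /negbT; rewrite negbK.
  + by rewrite -negb_or negbK -mulf_eq0 xNS.
  + case: xT => [xT|->]; last by rewrite orbT.
    apply/orP; left; apply/eqP/finset.setP => v; rewrite !inE.
    by apply/negP => /and3P[vN vS]; rewrite xT// eqxx.
Qed.

Definition height x : R := x N - x S.

(* Not in the carrier of T at the poles, where the division is by 0. *)
Definition equator x : {ptws V -> R} :=
  fun v => if (v == N) || (v == S) then 0 else x v / (1 - `|height x|).

(* (|t| + t) / 2 and (|t| - t) / 2 are the positive and negative parts of t. *)
Definition suspend (t : R) y : {ptws V -> R} :=
  fun v => if v == N then (`|t| + t) / 2
           else if v == S then (`|t| - t) / 2 else (1 - `|t|) * y v.

(** The two polar coordinates are nonnegative with product 0, so one of them vanishes. *)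
Lemma norm_height x : carrier R V crown x -> `|height x| = x N + x S.
Proof.
move=> /carrier_crownP[x0 _ /eqP xNS _]; rewrite /height.
have := x0 N; have := x0 S; move: xNS; rewrite mulf_eq0 => /orP[] /eqP -> xS xN.
  by rewrite sub0r add0r normrN ger0_norm.
by rewrite subr0 addr0 ger0_norm.
Qed.

Lemma norm_height_le1 x : carrier R V crown x -> `|height x| <= 1.
Proof.
move=> xK; rewrite norm_height//; have [x0 <- _] := xK.
by rewrite sum_poles lerDl; apply: sumr_ge0 => v _; exact: x0.
Qed.

Lemma sum_equator x : carrier R V crown x ->
  \sum_(v | (v != N) && (v != S)) x v = 1 - `|height x|.
Proof.
move=> xK; rewrite norm_height//; have [_ <- _] := xK.
by rewrite sum_poles addrC addKr.
Qed.

Lemma carrier_equator x :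
  carrier R V crown x -> `|height x| < 1 -> carrier R V T (equator x).
Proof.
move=> xK x1; have h0 : 0 < 1 - `|height x| by rewrite subr_gt0.
have [x0 _ _ xT] := (carrier_crownP x).1 xK.
have s1 := sum_equator xK.
split.
- move=> v; rewrite /equator; case: ifP => // _.
  by apply: divr_ge0; [exact: x0|exact: ltW].
- rewrite sum_poles /equator !eqxx orbT /= !add0r.
  transitivity ((\sum_(v | (v != N) && (v != S)) x v) / (1 - `|height x|)).
    by rewrite mulr_suml; apply: eq_bigr => v /andP[/negPf -> /negPf ->].
  by rewrite s1 divff// lt0r_neq0.
(* At a pole the remaining coordinates would sum to 0, against [h0]. *)
- case: xT => [xT|].
    by move: h0; rewrite -s1 big1 ?ltxx// => v /andP[]; exact: xT.
  suff -> : finset (fun v => equator x v != 0) =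
      finset (fun v => [&& v != N, v != S & x v != 0]) by [].
  apply/finset.setP => v; rewrite !inE /equator.
  have [->|vN] := eqVneq v N; first by rewrite /= eqxx.
  have [->|vS] := eqVneq v S; first by rewrite /= eqxx.
  by rewrite /= mulf_eq0 invr_eq0 (gt_eqF h0) orbF.
Qed.

Lemma height_suspend t y : height (suspend t y) = t.
Proof. by rewrite /height /suspend eqxx [S == N]eq_sym (negPf NS) eqxx; field. Qed.

(** If [|t| = 1], the factor [1 - |t|] erases [y], which may then lie outside the carrier of [T]. *)
Lemma carrier_suspend t y :
  `|t| <= 1 -> (`|t| < 1 -> carrier R V T y) -> carrier R V crown (suspend t y).
Proof.
move=> t1 yT.
have tN : 0 <= `|t| + t by have := ler_norm (- t); rewrite normrN -subr_ge0 opprK.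
have tS : 0 <= `|t| - t by rewrite subr_ge0 ler_norm.
have NSE : suspend t y N = (`|t| + t) / 2 /\ suspend t y S = (`|t| - t) / 2.
  by rewrite /suspend eqxx [S == N]eq_sym (negPf NS) eqxx.
have restE v : v != N -> v != S -> suspend t y v = (1 - `|t|) * y v.
  by rewrite /suspend => /negPf -> /negPf ->.
have sumE : \sum_(v | (v != N) && (v != S)) suspend t y v =
    (1 - `|t|) * \sum_(v | (v != N) && (v != S)) y v.
  by rewrite mulr_sumr; apply: eq_bigr => v /andP[]; exact: restE.
apply/carrier_crownP; rewrite sum_poles sumE; have [-> ->] := NSE.
(* The product of the polar coordinates is a quarter of [|t|^2 - t^2], hence 0. *)
have sq : `|t| * `|t| = t * t by rewrite -!expr2 real_normK// num_real.
have [t_lt1|t_ge1] := ltP `|t| 1.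
- have yK := yT t_lt1; have [y0 y1 yT'] := yK.
  have h0 : 0 < 1 - `|t| by rewrite subr_gt0.
  have yN := carrier_new_vertex NT yK; have yS := carrier_new_vertex ST yK.
  move: y1; rewrite sum_poles yN yS !add0r => y1.
  split.
  + move=> v; rewrite /suspend; case: ifP => _; first by rewrite divr_ge0.
    by case: ifP => _; [rewrite divr_ge0|rewrite mulr_ge0// ltW].
  + by rewrite y1; field.
  + apply/eqP; rewrite mulf_eq0 !mulf_eq0 invr_eq0 (pnatr_eq0 R 2) !orbF -mulf_eq0.
    by apply/eqP; rewrite mulrC -subr_sqr !expr2 sq subrr.
  + right; suff -> : finset (fun v => [&& v != N, v != S & suspend t y v != 0]) =
        finset (fun v => y v != 0) by [].
    apply/finset.setP => v; rewrite !inE.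
    have [->|vN] := eqVneq v N; first by rewrite yN eqxx.
    have [->|vS] := eqVneq v S; first by rewrite yS eqxx.
    by rewrite /= restE// mulf_eq0 (gt_eqF h0).
- have t1E : `|t| = 1 by apply/le_anti; rewrite t1.
  split.
  + move=> v; rewrite /suspend; case: ifP => _; first by rewrite divr_ge0.
    by case: ifP => _; [rewrite divr_ge0|rewrite t1E subrr mul0r].
  + by rewrite t1E subrr mul0r; field.
  + apply/eqP; rewrite mulf_eq0 !mulf_eq0 invr_eq0 (pnatr_eq0 R 2) !orbF -mulf_eq0.
    by apply/eqP; rewrite mulrC -subr_sqr !expr2 sq subrr.
  + by left => v vN vS; rewrite restE// t1E subrr mul0r.
Qed.

Lemma equator_suspend t y :
  `|t| < 1 -> carrier R V T y -> equator (suspend t y) = y.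
Proof.
move=> t1 yK; apply/funext => v; rewrite /equator height_suspend /suspend.
have h0 : 1 - `|t| != 0 by rewrite gt_eqF// subr_gt0.
have [->|vN] := eqVneq v N; first by rewrite (carrier_new_vertex NT yK).
have [->|vS] := eqVneq v S; first by rewrite (carrier_new_vertex ST yK).
by rewrite /= mulrC mulKf.
Qed.

Lemma suspend_height x y : carrier R V crown x ->
  (`|height x| < 1 -> y = equator x) -> suspend (height x) y = x.
Proof.
move=> xK yE; apply/funext => v; rewrite /suspend norm_height//.
have [->|vN] := eqVneq v N; first by rewrite /height; field.
have [->|vS] := eqVneq v S; first by rewrite /height; field.
have x1 := norm_height_le1 xK.
rewrite -norm_height//.
have [hlt|hge] := ltP `|height x| 1.
  rewrite (yE hlt) /equator (negPf vN) (negPf vS) /= mulrC mulfVK//.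
  by rewrite gt_eqF// subr_gt0.
have h1 : `|height x| = 1 by apply/le_anti; rewrite x1.
(* At a pole the other coordinates are nonnegative with sum 0, so each vanishes, whatever [y] is. *)
have := sum_equator xK; rewrite h1 subrr mul0r => /psumr_eq0P xv0.
by rewrite xv0 ?vN// => w _; have [x0 _ _] := xK; exact: x0.
Qed.

Lemma height_continuous : continuous height.
Proof.
move=> x; apply: (@cvgB R R _ (nbhs x)); exact: ptws_coord_continuous.
Qed.

Lemma equator_continuous x : `|height x| < 1 -> equator z @[z --> x] --> equator x.
Proof.
move=> x1; apply: (@cvg_ptws R V _ (nbhs x) _ equator (equator x)) => v.
rewrite /equator.
case: ifP => _.
  exact: cvg_cst.
apply: cvgM; first exact: ptws_coord_continuous.
apply: cvgV; first by rewrite gt_eqF// subr_gt0.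
apply: cvgB; first exact: cvg_cst.
by apply: cvg_norm; exact: height_continuous.
Qed.

End Crown.

(** * Coordinates on the sphere: height, tail and latitude radius *)

Section SphereCoordinates.
Variables (R : realType) (n : nat).

Definition row_cons (t : R) (u : 'rV[R]_n) : 'rV[R]_n.+1 :=
  \row_j oapp (u ord0) t (unlift ord0 j).

Definition row_tail (z : 'rV[R]_n.+1) : 'rV[R]_n := \row_i z ord0 (lift ord0 i).

Lemma row_consK t u : row_tail (row_cons t u) = u.
Proof. by apply/rowP => i; rewrite !mxE liftK. Qed.

Lemma row_cons_head t u : row_cons t u ord0 ord0 = t.
Proof. by rewrite mxE unlift_none. Qed.

Lemma row_cons_tail (z : 'rV[R]_n.+1) : row_cons (z ord0 ord0) (row_tail z) = z.
Proof.
apply/rowP => j; rewrite mxE.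
by case: unliftP => [i|] -> //=; rewrite mxE.
Qed.

Lemma sum_row_cons t u :
  \sum_i row_cons t u ord0 i ^+ 2 = t ^+ 2 + \sum_i u ord0 i ^+ 2.
Proof.
rewrite big_ord_recl row_cons_head; congr (_ + _); apply: eq_bigr => i _.
by rewrite mxE liftK.
Qed.

Lemma sum_scale (a : R) (u : 'rV[R]_n) :
  \sum_i (a *: u) ord0 i ^+ 2 = a ^+ 2 * \sum_i u ord0 i ^+ 2.
Proof. by rewrite mulr_sumr; apply: eq_bigr => i _; rewrite mxE exprMn. Qed.

End SphereCoordinates.

Lemma norm_sphere_coord (R : realType) (n : nat) (z : 'rV[R]_n.+1) i :
  sphere R n z -> `|z ord0 i| <= 1.
Proof.
move=> zS; rewrite -(expr_le1 (n := 2))// real_normK ?num_real// -zS.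
by rewrite (bigD1 i)//= lerDl; apply: sumr_ge0 => j _; exact: sqr_ge0.
Qed.

(** The radius of the slice of the unit sphere at height [t]. *)
Definition latitude_radius (R : realType) (t : R) : R := Num.sqrt (1 - t ^+ 2).

Section LatitudeRadius.
Variable R : realType.
Implicit Type t : R.

Lemma sqr_latitude_radius t : `|t| <= 1 -> latitude_radius t ^+ 2 = 1 - t ^+ 2.
Proof.
move=> t1; rewrite sqr_sqrtr// subr_ge0 -[t ^+ 2]real_normK ?num_real//.
by rewrite expr_le1.
Qed.

Lemma latitude_radius_gt0 t : `|t| < 1 -> 0 < latitude_radius t.
Proof.
move=> t1; rewrite sqrtr_gt0 subr_gt0 -[t ^+ 2]real_normK ?num_real//.
by rewrite expr_lt1.
Qed.

Lemma latitude_radius_pole t : `|t| = 1 -> latitude_radius t = 0.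
Proof.
move=> t1; rewrite /latitude_radius -[t ^+ 2]real_normK ?num_real//.
by rewrite t1 expr1n subrr sqrtr0.
Qed.

(** No bound on [t] is required because [Num.sqrt], being 0 on negative numbers, is continuous
    everywhere. *)
Lemma latitude_radius_continuous : continuous (@latitude_radius R).
Proof.
move=> t; apply: (cvg_comp (fun s : R => 1 - s ^+ 2)); last exact: sqrt_continuous.
by apply: cvgB; [exact: cvg_cst|exact: exprn_continuous].
Qed.

End LatitudeRadius.

Lemma sphere_cons (R : realType) (n : nat) (t : R) (u : 'rV[R]_n.+1) :
  `|t| <= 1 -> (`|t| < 1 -> sphere R n u) ->
  sphere R n.+1 (row_cons t (latitude_radius t *: u)).
Proof.
move=> t1 uS; rewrite /sphere /= sum_row_cons sum_scale sqr_latitude_radius//.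
have [tlt|tge] := ltP `|t| 1; first by rewrite (uS tlt) mulr1 addrC subrK.
have t1E : `|t| = 1 by apply/le_anti; rewrite t1.
by rewrite -[t ^+ 2]real_normK ?num_real// t1E expr1n subrr mul0r addr0.
Qed.

Lemma sphere_tail (R : realType) (n : nat) (z : 'rV[R]_n.+2) :
  sphere R n.+1 z ->
  \sum_i row_tail z ord0 i ^+ 2 = latitude_radius (z ord0 ord0) ^+ 2.
Proof.
move=> zS; rewrite sqr_latitude_radius ?(norm_sphere_coord _ zS)//.
have := zS; rewrite /sphere /= -{1}(row_cons_tail z) sum_row_cons => <-.
by rewrite addrC addKr.
Qed.

Lemma sphere_tail_normalized (R : realType) (n : nat) (z : 'rV[R]_n.+2) :
  sphere R n.+1 z -> `|z ord0 ord0| < 1 ->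
  sphere R n ((latitude_radius (z ord0 ord0))^-1 *: row_tail z).
Proof.
move=> zS zlt; rewrite /sphere /= sum_scale sphere_tail// -exprMn mulVf ?expr1n//.
by rewrite gt_eqF// latitude_radius_gt0.
Qed.

(** The squares of the tail sum to the squared slice radius, which is 0 at a pole. *)
Lemma sphere_pole_tail (R : realType) (n : nat) (z : 'rV[R]_n.+2) :
  sphere R n.+1 z -> `|z ord0 ord0| = 1 -> row_tail z = 0.
Proof.
move=> zS z1; have := sphere_tail zS.
rewrite latitude_radius_pole// expr0n /= => /psumr_eq0P z0.
apply/rowP => i; rewrite [RHS]mxE; apply/eqP; rewrite -sqrf_eq0; apply/eqP.
by apply: z0 => // j _; exact: sqr_ge0.
Qed.

(** * The homeomorphism between the crown and the sphere *)

Lemma crown_homeomorphic_sphere (R : realType) (V : finType) (T : {set {set V}})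
    (N S : V) (n : nat) :
  finset.set0 \notin T -> N != S ->
  N \notin vertices T -> S \notin vertices T ->
  homeomorphic (carrier R V T) (sphere R n) ->
  homeomorphic (carrier R V (bipyramidal_crown N S T)) (sphere R n.+1).
Proof.
move=> T0 NS NT ST [f [g [[fS gK] [fK gS] fc gc]]].
set K := bipyramidal_crown N S T.
pose h := @height R V N S; pose e := @equator R V N S.
pose r := @latitude_radius R.
pose F x := row_cons (h x) (r (h x) *: f (e x)).
pose w (z : 'rV[R]_n.+2) := z ord0 ord0.
(* Rescales the slice through [z] to the unit n-sphere. At a pole the inverse of 0 is 0, so [p z] is
   the zero row, off the sphere; the value of [g] there is unconstrained but gets multiplied by 0 in
   [G]. *)
pose p z := (r (w z))^-1 *: row_tail z.
pose G z := suspend N S (w z) (g (p z)).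
have hle x : carrier R V K x -> `|h x| <= 1 by exact: norm_height_le1.
have eK x : carrier R V K x -> `|h x| < 1 -> carrier R V T (e x).
  exact: carrier_equator.
have wle z : sphere R n.+1 z -> `|w z| <= 1 by exact: norm_sphere_coord.
have pS z : sphere R n.+1 z -> `|w z| < 1 -> sphere R n (p z).
  exact: sphere_tail_normalized.
have FS x : carrier R V K x -> sphere R n.+1 (F x).
  by move=> xK; apply: sphere_cons => [|xlt]; [exact: hle|exact/fS/eK].
have GK z : sphere R n.+1 z -> carrier R V K (G z).
  by move=> zS; apply: carrier_suspend => // [|zlt]; [exact: wle|exact/gK/pS].
(* Coordinate 0 is the height; each other one is a product suited to [cvgM_bounded]. *)
pose FE' j x := oapp (fun i => r (h x) * f (e x) ord0 i) (h x) (unlift ord0 j).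
have FE x j : F x ord0 j = FE' j x.
  by rewrite mxE /FE'; case: (unlift _ _) => //= i; rewrite mxE.
exists F, G; split; first by split.
- split => [x /set_mem xK|z /set_mem zS].
  + rewrite /G /F /w row_cons_head; apply: (@suspend_height R V T) => // xlt.
    rewrite /p /w row_cons_head row_consK scalerA mulVf ?scale1r ?fK//.
      by apply/mem_set/eK.
    by rewrite gt_eqF// latitude_radius_gt0.
  + rewrite /F /G /h height_suspend// -/(w z) -[RHS]row_cons_tail; congr row_cons.
    have [zlt|zge] := ltP `|w z| 1.
      rewrite /e (equator_suspend (T := T))//; last exact/gK/pS.
      rewrite gS; last exact/mem_set/pS.
      by rewrite scalerA mulfV ?scale1r// gt_eqF// latitude_radius_gt0.
    have w1 : `|w z| = 1 by apply/le_anti; rewrite wle.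
    by rewrite sphere_pole_tail// /r latitude_radius_pole// scale0r.
- apply/subspace_continuousP => x xK.
  have hx : h z @[z --> within (carrier R V K) (nbhs x)] --> h x.
    by apply: cvg_within_filter; exact: height_continuous.
  have inK : \forall z \near within (carrier R V K) (nbhs x), carrier R V K z.
    exact: withinT.
  suff : F z @[z --> within (carrier R V K) (nbhs x)] --> F x by [].
  apply: cvg_rV => j; rewrite FE (_ : (fun z => F z ord0 j) = FE' j); last first.
    by apply/funext => z; rewrite FE.
  rewrite /FE'; case: (unlift _ _) => [i|] //=.
  (* The slice radius may tend to 0; where it is nonzero, [f (e z)] is on the unit sphere, so its
     coordinates are bounded by 1. *)
  apply: cvgM_bounded.
  + by apply: cvg_comp hx _; exact: latitude_radius_continuous.
  + move=> rx0.
    have xlt : `|h x| < 1.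
      rewrite lt_neqAle hle// andbT; apply: contra rx0 => /eqP x1.
      by rewrite /r latitude_radius_pole.
    (* The limit must be taken within the carrier of [T], where alone [f] is continuous; nearby
       points still have height below 1 in absolute value. *)
    have ex : e z @[z --> within (carrier R V K) (nbhs x)] -->
        within (carrier R V T) (nbhs (e x)).
      apply: cvg_to_within.
        by apply: cvg_within_filter; exact: equator_continuous.
      have hlt : \forall z \near within (carrier R V K) (nbhs x), `|h z| < 1.
        exact: (cvgr_lt _ (cvg_norm hx)).
      by apply: filterS2 inK hlt => z; exact: eK.
    have fe := cvg_comp _ _ ex ((subspace_continuousP _ _).1 fc _ (eK _ xK xlt)).
    exact: (cvg_comp _ (fun u : 'rV[R]_n.+1 => u ord0 i) fe
      (@coord_continuous R _ _ _ _ _)).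
  + apply: filterS inK => z zK rz0; apply: norm_sphere_coord; apply: fS.
    apply: eK => //; rewrite lt_neqAle hle// andbT.
    by apply: contra rz0 => /eqP z1; rewrite /r latitude_radius_pole.
- apply/subspace_continuousP => z zS.
  have wz : w y @[y --> within (sphere R n.+1) (nbhs z)] --> w z.
    by apply: cvg_within_filter; exact: coord_continuous.
  have inS : \forall y \near within (sphere R n.+1) (nbhs z), sphere R n.+1 y.
    exact: withinT.
  have nwz : `|w y| @[y --> within (sphere R n.+1) (nbhs z)] --> `|w z|.
    exact: cvg_norm.
  suff : G y @[y --> within (sphere R n.+1) (nbhs z)] --> G z by [].
  apply: cvg_ptws => v; rewrite /G /suspend.
  case: ifP => _; first by apply: cvgMr_tmp; exact: cvgD nwz wz.
  case: ifP => _; first by apply: cvgMr_tmp; exact: cvgB nwz wz.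
  have lt1 y : sphere R n.+1 y -> 1 - `|w y| != 0 -> `|w y| < 1.
    move=> yS y0; rewrite lt_neqAle wle// andbT.
    by apply: contra y0 => /eqP ->; rewrite subrr.
  (* The factor [1 - |w y|] may tend to 0; where it is nonzero, [g (p y)] is in the carrier of [T],
     so its coordinates lie between 0 and 1. *)
  apply: cvgM_bounded.
  + by apply: cvgB nwz; exact: cvg_cst.
  + move=> /(lt1 _ zS) zlt.
    have pz : p y @[y --> within (sphere R n.+1) (nbhs z)] -->
        within (sphere R n) (nbhs (p z)).
      apply: cvg_to_within.
        apply: cvg_rV => i; rewrite /p; rewrite !mxE; under eq_fun do rewrite !mxE.
        apply: cvgM.
          apply: cvgV; first by rewrite gt_eqF// latitude_radius_gt0.
          by apply: cvg_comp wz _; exact: latitude_radius_continuous.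
        by apply: cvg_within_filter; exact: coord_continuous.
      have wlt : \forall y \near within (sphere R n.+1) (nbhs z), `|w y| < 1.
        exact: (cvgr_lt _ nwz).
      by apply: filterS2 inS wlt => y; exact: pS.
    have gp := cvg_comp _ _ pz ((subspace_continuousP _ _).1 gc _ (pS _ zS zlt)).
    exact: (cvg_comp _ (fun y : {ptws V -> R} => y v) gp
      (@ptws_coord_continuous R V v _)).
  + apply: filterS inS => y yS /(lt1 _ yS) ylt.
    have gyK := gK _ (pS _ yS ylt); rewrite ger0_norm; first exact: carrier_le1 gyK.
    by case: gyK.
Qed.

Theorem mainTheorem3 (R : realType) (n : nat) (V : finType)
    (T : {set {set V}}) (c : {set V} -> color) (N S : V) :
  (1 <= n)%N ->
  facet_2colored_triangulation R n T c (sphere R n) ->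
  N != S -> N \notin vertices T -> S \notin vertices T ->
  facet_2colored_triangulation R n.+1 (bipyramidal_crown N S T)
    (crown_coloring N S c) (sphere R n.+1).
Proof.
move=> n1 [[Tn TS] Tc] NS NT ST; have [[T0 _] _ _] := Tn.
split; first split.
- exact: crown_complex.
- exact: crown_homeomorphic_sphere.
- exact: crown_facet_2coloring.
Qed.
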